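(* Let $r$ be a positive integer, $k\in\mathbb Z$, and $a_1,\dots,a_r$ nonzero complex numbers. Then for every integer $n\ge0$, $$\sum_{m=0}^n\binom{n+1}{m}(-1)^{n-m}S_m^{(r,k)}(a_1,\dots,a_r)=\sum_{l=0}^n\sum_{m=0}^l(-1)^{l-m}\binom{l}{m}\binom{n+1}{l+1}B_m^{(k-1)}B_{n-l}(a_1,\dots,a_r).$$
   Context: For an integer $k$, ${\rm Li}_k(x)=\sum_{m=1}^\infty x^m/m^k$. For $r\in\mathbb Z_{>0}$, $k\in\mathbb Z$ and nonzero complex $a_1,\dots,a_r$, the numbers $S_n^{(r,k)}(a_1,\dots,a_r)$ are defined by $\frac{t^r}{\prod_{j=1}^r(e^{a_jt}-1)}\frac{{\rm Li}_k(1-e^{-t})}{1-e^{-t}}=\sum_{n\ge0}S_n^{(r,k)}(a_1,\dots,a_r)\frac{t^n}{n!}$. The poly-Bernoulli numbers $B_n^{(k)}$ (for any integer $k$) are defined by $\frac{{\rm Li}_k(1-e^{-t})}{1-e^{-t}}=\sum_{n\ge0}B_n^{(k)}\frac{t^n}{n!}$. The Barnes' multiple Bernoulli numbers are defined by $\frac{t^r}{\prod_{j=1}^r(e^{a_jt}-1)}=\sum_{n\ge0}B_n(a_1,\dots,a_r)\frac{t^n}{n!}$. *)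

(* Defs.v *)
From HB Require Import structures.
From mathcomp Require Import all_boot all_order all_algebra.
From mathcomp Require Import boolp reals.
From mathcomp Require Export complex.

Set Implicit Arguments.
Unset Strict Implicit.
Unset Printing Implicit Defensive.

Import Order.TTheory GRing.Theory Num.Theory.
Local Open Scope ring_scope.

(* Generating functions are formal power series, given by their coefficients:
   f : fps F stands for \sum_n f n t^n. *)
Definition fps (F : Type) := nat -> F.

Section FormalPowerSeries.
Variable F : fieldType.
Implicit Types f g : fps F.

Definition fps_one : fps F := fun n => (n == 0%N)%:R.
Definition fps_Xn (r : nat) : fps F := fun n => (n == r)%:R.
Definition fps_sub f g : fps F := fun n => f n - g n.
Definition fps_mul f g : fps F := fun n => \sum_(i < n.+1) f i * g (n - i)%N.
Definition fps_pow f (m : nat) : fps F := iter m (fps_mul f) fps_one.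

(* f(g(t)); meaningful only when g 0 = 0, in which case g ^ m contributes
   nothing to the coefficient of t^n for m > n. *)
Definition fps_comp f g : fps F :=
  fun n => \sum_(m < n.+1) f m * fps_pow g m n.

(* e^{a t} *)
Definition fps_exp (a : F) : fps F := fun n => a ^+ n / n`!%:R.

(* The least exponent with a nonzero coefficient (0 for the zero series). *)
Definition fps_order g : nat :=
  if pselect (exists n, g n != 0) is left g_neq0 then ex_minn g_neq0 else 0.

(* Long division: fps_div_seq f g n lists the first n coefficients of f / g. *)
Fixpoint fps_div_seq f g (n : nat) : seq F :=
  if n is n'.+1 then
    let s := fps_div_seq f g n' in
    let v := fps_order g in
    rcons s ((f (n' + v)%N - \sum_(i < n') s`_i * g (n' - i + v)%N) / g v)
  else [::].

(* f / g is the power series h with h g = f, whenever g is nonzero and the order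
   of g is at most that of f (see fps_divK). *)
Definition fps_div f g : fps F := fun n => (fps_div_seq f g n.+1)`_n.

(* The c_n such that f(t) = \sum_n c_n t^n / n!. *)
Definition egf_coef f (n : nat) : F := n`!%:R * f n.

(* Li_k(x) = \sum_(m >= 1) x^m / m^k *)
Definition polylog (k : int) : fps F :=
  fun m => if m == 0%N then 0 else (m%:R ^ k)^-1.

(* 1 - e^{-t} *)
Definition one_sub_expN : fps F := fps_sub fps_one (fps_exp (-1)).

(* Li_k(1 - e^{-t}) / (1 - e^{-t}) *)
Definition polyBernoulli_gf (k : int) : fps F :=
  fps_div (fps_comp (polylog k) one_sub_expN) one_sub_expN.

(* \prod_j (e^{a_j t} - 1) *)
Definition barnes_den (r : nat) (a : 'I_r -> F) : fps F :=
  \big[fps_mul/fps_one]_(j < r) fps_sub (fps_exp (a j)) fps_one.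

(* t^r / \prod_j (e^{a_j t} - 1) *)
Definition barnes_gf (r : nat) (a : 'I_r -> F) : fps F :=
  fps_div (fps_Xn r) (barnes_den a).

(* B_n^(k) *)
Definition polyBernoulli (k : int) (n : nat) : F :=
  egf_coef (polyBernoulli_gf k) n.

(* B_n(a_1, ..., a_r) *)
Definition barnesBernoulli (r : nat) (a : 'I_r -> F) (n : nat) : F :=
  egf_coef (barnes_gf a) n.

(* S_n^(r,k)(a_1, ..., a_r) *)
Definition barnesPolyBernoulli (r : nat) (k : int) (a : 'I_r -> F) (n : nat) : F :=
  egf_coef (fps_mul (barnes_gf a) (polyBernoulli_gf k)) n.

Lemma fps_order_neq0 g : (exists n, g n != 0) -> g (fps_order g) != 0.
Proof.
by rewrite /fps_order; case: pselect => // h _; case: ex_minnP.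
Qed.

Lemma fps_order_le g n : g n != 0 -> (fps_order g <= n)%N.
Proof.
rewrite /fps_order; case: pselect => // h gn.
by case: ex_minnP => m _; apply.
Qed.

Lemma fps_lt_order g n : (n < fps_order g)%N -> g n = 0.
Proof.
move=> lt_n; apply/eqP/negP => /negP /fps_order_le.
by rewrite leqNgt lt_n.
Qed.

Lemma size_fps_div_seq f g n : size (fps_div_seq f g n) = n.
Proof. by elim: n => //= n IHn; rewrite size_rcons IHn. Qed.

Lemma nth_fps_div_seq f g n i :
  (i < n)%N -> (fps_div_seq f g n)`_i = fps_div f g i.
Proof.
elim: n => // n IHn; rewrite ltnS leq_eqVlt => /predU1P[-> //|lt_in].
by rewrite /= nth_rcons size_fps_div_seq lt_in IHn.
Qed.

Lemma fps_divE f g n (v := fps_order g) :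
  fps_div f g n =
  (f (n + v)%N - \sum_(i < n) fps_div f g i * g (n - i + v)%N) / g v.
Proof.
rewrite {1}/fps_div /= nth_rcons size_fps_div_seq ltnn eqxx.
by under eq_bigr => i _ do rewrite nth_fps_div_seq //.
Qed.

Lemma fps_divK f g :
    (exists n, g n != 0) ->
    (forall i, (i < fps_order g)%N -> f i = 0) ->
  fps_mul (fps_div f g) g = f.
Proof.
move=> g_neq0 f_lt; apply/funext => n; rewrite /fps_mul.
have [lt_n|le_n] := ltnP n (fps_order g).
  rewrite f_lt // big1 // => i _.
  by rewrite [g _]fps_lt_order ?mulr0 // (leq_ltn_trans (leq_subr _ _)).
set v := fps_order g in le_n *.
rewrite -(subnK le_n); set m := (n - v)%N.
rewrite -addnS big_split_ord /= [X in X + _](_ : _ =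
  \sum_(i < m) fps_div f g i * g (m - i + v)%N); last first.
  by apply: eq_bigr => i _; rewrite addnBAC // ltnW.
rewrite big_ord_recl /= addn0 addKn [X in _ + (_ + X)]big1 => [|i _].
  rewrite addr0 [fps_div f g m]fps_divE divfK ?fps_order_neq0 //.
  by rewrite addrC subrK.
rewrite [g _]fps_lt_order ?mulr0 // /bump /= subnDl -/v add1n.
by case: (v) i => [[]|w i] //; rewrite subSS ltnS leq_subr.
Qed.

End FormalPowerSeries.

Section DefiningEquations.
Variable F : numFieldType.

Lemma one_sub_expN1 : one_sub_expN F 1 = 1.
Proof. by rewrite /one_sub_expN /fps_sub /fps_one /fps_exp expr1 divr1 sub0r opprK. Qed.

Lemma polyBernoulli_gfK (k : int) :
  fps_mul (polyBernoulli_gf F k) (one_sub_expN F) =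
  fps_comp (polylog F k) (one_sub_expN F).
Proof.
have e1 : one_sub_expN F 1 != 0 by rewrite one_sub_expN1 oner_eq0.
apply: fps_divK => [|i lt_i]; first by exists 1%N.
have := leq_trans lt_i (fps_order_le e1); rewrite ltnS leqn0 => /eqP->.
by rewrite /fps_comp big_ord1 mul0r.
Qed.

Lemma barnes_den_coef (r : nat) (a : 'I_r -> F) :
  (forall i, (i < r)%N -> barnes_den a i = 0) /\ barnes_den a r = \prod_j a j.
Proof.
elim: r a => [|r IHr] a; rewrite /barnes_den.
  by split=> //; rewrite !big_ord0.
rewrite !big_ord_recl; have [lt_r eq_r] := IHr (fun j => a (lift ord0 j)).
rewrite -/(barnes_den _); set h := fps_sub _ _.
have h0 : h 0%N = 0 by rewrite /h /fps_sub /fps_exp /fps_one divr1 subrr.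
have h1 : h 1%N = a ord0 by rewrite /h /fps_sub /fps_exp /fps_one divr1 subr0.
split=> [i lt_i|]; rewrite /fps_mul big_ord_recl /= h0 mul0r add0r.
  apply: big1 => j _; rewrite lt_r ?mulr0 // /bump /= add1n.
  by case: i lt_i j => [|i] lt_i [j lt_j] //=; rewrite subSS (leq_ltn_trans (leq_subr _ _)).
rewrite big_ord_recl /= h1 subSS subn0 eq_r [X in _ + X]big1 ?addr0 // => j _.
rewrite lt_r ?mulr0 // /bump /= !add1n subSS.
by case: r {IHr a lt_r eq_r h h0 h1} j => [[]|r j] //; rewrite subSS ltnS leq_subr.
Qed.

Lemma barnes_gfK (r : nat) (a : 'I_r -> F) :
  (forall j, a j != 0) -> fps_mul (barnes_gf a) (barnes_den a) = fps_Xn F r.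
Proof.
move=> a_neq0; have [_ dr] := barnes_den_coef a.
have d_neq0 : barnes_den a r != 0 by rewrite dr; apply/prodf_neq0 => j _.
apply: fps_divK => [|i lt_i]; first by exists r.
by rewrite /fps_Xn ltn_eqF // (leq_trans lt_i) // fps_order_le.
Qed.

End DefiningEquations.

(* Main.v *)
Require Import Defs.
From mathcomp Require Import all_boot all_order all_algebra.
From mathcomp Require Import boolp reals complex.

(** Put [u = 1 - e^{-t}], [P] for the Barnes generating function and [G_k] for
    the poly-Bernoulli one.  Both sides are the coefficient of
    [t^(n+1) / (n+1)!] in [P G_k u = P Li_k(u)].  Expanding [(P G_k) u] gives the
    left-hand side; the right-hand side comes from [P Li_k(u)] and
    [d/dt Li_k(u) = (Li_(k-1)(u) / u) u' = G_(k-1) e^{-t}]. *)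

Set Implicit Arguments.
Unset Strict Implicit.
Unset Printing Implicit Defensive.

Import Order.TTheory GRing.Theory Num.Theory.
Local Open Scope ring_scope.

Section FormalPowerSeriesTheory.
Variable F : fieldType.
Implicit Types f g h : fps F.

(** Coefficients of a product below index [N] depend only on those of the factors below [N], so
    commutativity, associativity and the Leibniz rule can be inherited from polynomials. *)
Definition fps_trunc N f : {poly F} := \poly_(i < N) f i.

Lemma coef_fps_trunc_mul N f g n : (n < N)%N ->
  (fps_trunc N f * fps_trunc N g)`_n = fps_mul f g n.
Proof.
move=> lt_nN; rewrite coefM; apply: eq_bigr => i _; rewrite !coef_poly.
by rewrite (leq_ltn_trans (leq_ord i) lt_nN) (leq_ltn_trans (leq_subr i n) lt_nN).
Qed.

Lemma fps_mulC f g : fps_mul f g = fps_mul g f.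
Proof.
by apply/funext => n; rewrite -!(@coef_fps_trunc_mul n.+1) // mulrC.
Qed.

Lemma fps_mulA f g h : fps_mul f (fps_mul g h) = fps_mul (fps_mul f g) h.
Proof.
apply/funext => n; transitivity
  ((fps_trunc n.+1 f * fps_trunc n.+1 g * fps_trunc n.+1 h)`_n).
  rewrite -mulrA coefM; apply: eq_bigr => i _.
  by rewrite coef_poly ltn_ord coef_fps_trunc_mul // ltnS leq_subr.
rewrite coefM; apply: eq_bigr => i _.
by rewrite coef_fps_trunc_mul // coef_poly ltnS leq_subr.
Qed.

(** With [v] the order of [h], coefficient [n + v] of [e h] is [e n * h v] plus terms in the [e i]
    with [i < n], so strong induction recovers each [e n]. *)
Lemma fps_mul_cancelr f g h : (exists n, h n != 0) ->
  fps_mul f h = fps_mul g h -> f = g.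
Proof.
move=> /fps_order_neq0; set v := fps_order h => hv_neq0 fh_gh.
have mulE e n : fps_mul e h (n + v)%N =
    \sum_(i < n) e i * h (n + v - i)%N + e n * h v.
  rewrite /fps_mul -addnS big_split_ord /= big_ord_recl /= addn0 addKn.
  (* Past index [n], [h] is evaluated below its order; for [v = 0] no such index exists. *)
  rewrite [X in _ + (_ + X)]big1 ?addr0 // => i _.
  rewrite [h _]fps_lt_order ?mulr0 // /bump /= subnDl -/v add1n.
  by case: (v) i => [[]|w i] //; rewrite subSS ltnS leq_subr.
apply/funext => n; elim/ltn_ind: n => n IHn.
have /eqP := congr1 (fun e => e (n + v)%N) fh_gh; rewrite /= !mulE.
under eq_bigr => i _ do rewrite IHn //.
by move/eqP/addrI/(mulIf hv_neq0).
Qed.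

Definition fps_deriv f : fps F := fun n => n.+1%:R * f n.+1.

Lemma fps_deriv_mul f g n : fps_deriv (fps_mul f g) n =
  fps_mul (fps_deriv f) g n + fps_mul f (fps_deriv g) n.
Proof.
(* The derivative reads coefficient [n.+1], hence truncation at [n.+2]. *)
rewrite /fps_deriv mulr_natl -(@coef_fps_trunc_mul n.+2) // -coef_deriv derivM.
rewrite coefD !coefM; congr (_ + _); apply: eq_bigr => i _.
  rewrite coef_deriv !coef_poly ltnS ltn_ord mulr_natl.
  by rewrite ltnW // !ltnS leq_subr.
by rewrite coef_deriv !coef_poly !ltnS leq_subr mulr_natl (ltnW (ltn_ord i)).
Qed.

Lemma fps_deriv_pow g m n : fps_deriv (fps_pow g m.+1) n =
  m.+1%:R * fps_mul (fps_pow g m) (fps_deriv g) n.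
Proof.
elim: m n => [|m IHm] n; rewrite [fps_pow _ _.+1]/= fps_deriv_mul.
  rewrite [X in _ + X]big1 => [|i _]; last by rewrite /fps_deriv mulr0 mulr0.
  by rewrite addr0 fps_mulC mul1r.
rewrite fps_mulC -[m.+2%:R]natr1 mulrDl mul1r addrC; congr (_ + _).
rewrite -fps_mulA [RHS]mulr_sumr; apply: eq_bigr => i _.
by rewrite IHm mulrCA.
Qed.

Lemma fps_pow_lt g m n : g 0%N = 0 -> (n < m)%N -> fps_pow g m n = 0.
Proof.
move=> g0; elim: m n => // m IHm n lt_nm.
rewrite /= /fps_mul big_ord_recl g0 mul0r add0r big1 // => i _.
rewrite IHm ?mulr0 // lift0.
by case: n lt_nm i => [|n] lt_nm [i lt_i] //=; rewrite subSS (leq_ltn_trans (leq_subr _ _)).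
Qed.

(** The added terms vanish because [t^m] divides [g^m]. A summation bound common to all coefficients
    is what allows sums to be exchanged below. *)
Lemma fps_comp_widen f g N n : g 0%N = 0 -> (n < N)%N ->
  fps_comp f g n = \sum_(m < N) f m * fps_pow g m n.
Proof.
move=> g0 lt_nN; rewrite /fps_comp -(subnKC lt_nN) big_split_ord /=.
rewrite [X in _ = _ + X]big1 ?addr0 // => i _.
by rewrite -[fps_mul _ _]/(fps_pow g (n + i).+1) fps_pow_lt ?mulr0 // ltnS leq_addr.
Qed.

(** Chain rule: differentiate each power of [g], then exchange the sum over powers with the Cauchy
    product. *)
Lemma fps_deriv_comp f g : g 0%N = 0 ->
  fps_deriv (fps_comp f g) = fps_mul (fps_comp (fps_deriv f) g) (fps_deriv g).
Proof.
move=> g0; apply/funext => n; rewrite {1}/fps_deriv {1}/fps_comp.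
(* The term in [f 0] drops out, since [g^0 = 1] has no coefficient at [n.+1]. *)
rewrite big_ord_recl /= mulr0 add0r mulr_sumr.
transitivity (\sum_(m < n.+1)
    fps_deriv f m * fps_mul (fps_pow g m) (fps_deriv g) n).
  apply: eq_bigr => m _; rewrite /bump /= add1n -[fps_mul g _]/(fps_pow g m.+1).
  by rewrite mulrCA -[_ * fps_pow _ _ _]/(fps_deriv _ n) fps_deriv_pow mulrA [f _ * _]mulrC.
under eq_bigr => m _ do rewrite mulr_sumr.
rewrite exchange_big; apply: eq_bigr => i _ /=.
rewrite (fps_comp_widen _ g0 (ltn_ord i)) mulr_suml.
by apply: eq_bigr => m _; rewrite mulrA.
Qed.

Lemma fps_comp_mulX f h g : g 0%N = 0 -> f 0%N = 0 ->
  (forall n, f n.+1 = h n) -> fps_comp f g = fps_mul (fps_comp h g) g.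
Proof.
move=> g0 f0 fS; rewrite fps_mulC; apply/funext => n.
(* One term more than needed is kept, so that removing the zero term in [f 0] and shifting leaves
   exactly [n.+1] terms in [h]. *)
rewrite (@fps_comp_widen _ _ n.+2) // big_ord_recl f0 mul0r add0r.
transitivity (\sum_(m < n.+1) h m * fps_mul g (fps_pow g m) n).
  by apply: eq_bigr => m _; rewrite lift0 fS.
under eq_bigr => m _ do rewrite mulr_sumr.
rewrite exchange_big; apply: eq_bigr => i _ /=.
rewrite (@fps_comp_widen _ _ n.+1) ?ltnS ?leq_subr // mulr_sumr.
by apply: eq_bigr => m _; rewrite mulrCA.
Qed.

End FormalPowerSeriesTheory.

Section PolyBernoulli.
Variable F : numFieldType.
Implicit Types f g : fps F.

Lemma fact_natr_neq0 n : n`!%:R != 0 :> F.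
Proof. by rewrite pnatr_eq0 -lt0n fact_gt0. Qed.

Lemma egf_coef_mul f g n : egf_coef (fps_mul f g) n =
  \sum_(i < n.+1) 'C(n, i)%:R * egf_coef f i * egf_coef g (n - i).
Proof.
rewrite /egf_coef /fps_mul mulr_sumr; apply: eq_bigr => i _.
rewrite -(bin_fact (leq_ord i)) !natrM -!mulrA; congr (_ * (_ * _)).
by rewrite mulrCA.
Qed.

Lemma egf_coef_deriv f n : egf_coef (fps_deriv f) n = egf_coef f n.+1.
Proof. by rewrite /egf_coef /fps_deriv factS natrM mulrA [_ * n.+1%:R]mulrC. Qed.

Lemma egf_coef_exp (a : F) n : egf_coef (fps_exp a) n = a ^+ n.
Proof. by rewrite /egf_coef /fps_exp mulrC divfK ?fact_natr_neq0. Qed.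

Lemma one_sub_expN0 : one_sub_expN F 0 = 0.
Proof. by rewrite /one_sub_expN /fps_sub /fps_one /fps_exp divr1 subrr. Qed.

Lemma egf_coef_one_sub_expN n : egf_coef (one_sub_expN F) n.+1 = (-1) ^+ n.
Proof.
rewrite /egf_coef /one_sub_expN /fps_sub /fps_one /= sub0r mulrN.
by rewrite -[_ * _]/(egf_coef _ _) egf_coef_exp exprS mulN1r opprK.
Qed.

Lemma deriv_one_sub_expN : fps_deriv (one_sub_expN F) = fps_exp (-1).
Proof.
apply/funext => n; apply: (mulfI (fact_natr_neq0 n)).
rewrite -![_ * _]/(egf_coef _ _) egf_coef_deriv.
by rewrite egf_coef_one_sub_expN egf_coef_exp.
Qed.

(** This is [x Li_k'(x) = Li_(k-1)(x)], in the coefficient form required by [fps_comp_mulX]. *)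
Lemma polylog_deriv (k : int) n :
  polylog F (k - 1) n.+1 = fps_deriv (polylog F k) n.
Proof.
rewrite /polylog /fps_deriv /= expfzDr ?pnatr_eq0 // invfM mulrC.
by rewrite exprN1 invrK.
Qed.

(** Multiplied by [u = 1 - e^{-t}], both sides become [Li_(k-1)(u)]; the factor [u] cancels because
    its coefficient of [t] is 1. *)
Lemma polyBernoulli_gf_comp (k : int) : polyBernoulli_gf F (k - 1) =
  fps_comp (fps_deriv (polylog F k)) (one_sub_expN F).
Proof.
apply: (@fps_mul_cancelr _ _ _ (one_sub_expN F)).
  by exists 1%N; rewrite one_sub_expN1 oner_neq0.
rewrite polyBernoulli_gfK; apply: fps_comp_mulX => //.
  exact: one_sub_expN0.
exact: polylog_deriv.
Qed.

Lemma deriv_polylog_comp (k : int) :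
  fps_deriv (fps_comp (polylog F k) (one_sub_expN F)) =
  fps_mul (polyBernoulli_gf F (k - 1)) (fps_exp (-1)).
Proof.
by rewrite fps_deriv_comp ?one_sub_expN0 // deriv_one_sub_expN -polyBernoulli_gf_comp.
Qed.

Lemma egf_coef_polylog_comp (k : int) l :
  egf_coef (fps_comp (polylog F k) (one_sub_expN F)) l.+1 =
  \sum_(m < l.+1) 'C(l, m)%:R * polyBernoulli F (k - 1) m * (-1) ^+ (l - m).
Proof.
rewrite -egf_coef_deriv deriv_polylog_comp egf_coef_mul.
by apply: eq_bigr => m _; rewrite egf_coef_exp.
Qed.

Lemma barnesPolyBernoulli_sum (r : nat) (k : int) (a : 'I_r -> F) n :
  \sum_(0 <= m < n.+1)
     'C(n.+1, m)%:R * (-1) ^+ (n - m) * barnesPolyBernoulli k a m =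
  \sum_(0 <= l < n.+1) \sum_(0 <= m < l.+1)
     (-1) ^+ (l - m) * 'C(l, m)%:R * 'C(n.+1, l.+1)%:R *
     polyBernoulli F (k - 1) m * barnesBernoulli a (n - l).
Proof.
rewrite !big_mkord.
transitivity (egf_coef (fps_mul (fps_mul (barnes_gf a) (polyBernoulli_gf F k))
                                (one_sub_expN F)) n.+1).
  (* The top term [m = n.+1] carries the constant coefficient of [u], which is 0; hence the sum
     stops at [n]. *)
  rewrite egf_coef_mul [RHS]big_ord_recr /= subnn.
  rewrite [egf_coef _ 0]mulrC one_sub_expN0 mul0r mulr0 addr0; apply: eq_bigr => m _.
  by rewrite subSn ?leq_ord // egf_coef_one_sub_expN mulrAC.
have comp0 : egf_coef (fps_comp (polylog F k) (one_sub_expN F)) 0 = 0.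
  by rewrite /egf_coef /fps_comp big_ord1 mul0r mulr0.
(* With [Li_k(u)] as first factor, its zero constant term removes index 0; the remaining indices
   [l.+1] produce ['C(n.+1, l.+1)] and the Barnes index [n - l]. *)
rewrite -fps_mulA polyBernoulli_gfK fps_mulC egf_coef_mul [LHS]big_ord_recl.
rewrite comp0 mulr0 mul0r add0r.
apply: eq_bigr => l _; rewrite lift0 subSS big_mkord.
rewrite egf_coef_polylog_comp mulr_sumr mulr_suml.
apply: eq_bigr => m _; rewrite -/(barnesBernoulli a _); congr (_ * _).
by rewrite [RHS]mulrAC [RHS]mulrC -[_ * _ * polyBernoulli _ _ _]mulrA [(-1) ^+ _ * _]mulrC.
Qed.

End PolyBernoulli.

Theorem theorem5 (R : realType) (r : nat) (k : int) (a : 'I_r -> R[i])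
    (r_gt0 : (0 < r)%N) (a_neq0 : forall j : 'I_r, a j != 0) (n : nat) :
  \sum_(0 <= m < n.+1)
     'C(n.+1, m)%:R * (-1) ^+ (n - m) * barnesPolyBernoulli k a m =
  \sum_(0 <= l < n.+1) \sum_(0 <= m < l.+1)
     (-1) ^+ (l - m) * 'C(l, m)%:R * 'C(n.+1, l.+1)%:R *
     polyBernoulli R[i] (k - 1) m * barnesBernoulli a (n - l).
Proof. exact: barnesPolyBernoulli_sum. Qed.
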